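(* There exist a countable dense set $S$ in $c_0$ and a step-isometry $T:S\to S$ that does not extend to a step-isometry on the whole of $c_0$; that is, there is no step-isometry $\bar T:c_0\to c_0$ with $\bar T|_S=T$.
   Context: $c_0$ is the Banach space of real sequences tending to zero, with the sup norm. Let $S$ be a dense set in a normed space $X$ (possibly $S=X$). A bijection $T:S\to S$ is a step-isometry (on $S$) if for all $x,y\in S$ we have $\lfloor\|x-y\|\rfloor=\lfloor\|T(x)-T(y)\|\rfloor$; equivalently, for every positive integer $k$ and all $x,y\in S$, $\|x-y\|<k$ if and only if $\|T(x)-T(y)\|<k$. *)

(* Defs.v *)
From HB Require Import structures.
From mathcomp Require Import all_boot all_order all_algebra.
From mathcomp Require Import all_classical all_reals all_analysis.

Set Implicit Arguments.
Unset Strict Implicit.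
Unset Printing Implicit Defensive.

Import Order.TTheory GRing.Theory Num.Theory.
Import numFieldNormedType.Exports.

Local Open Scope classical_set_scope.
Local Open Scope ring_scope.

(** [T] is a total function on [X]; only its restriction to [S] matters. *)
Definition step_isometry (R : realType) (X : normedModType R)
    (S : set X) (T : X -> X) : Prop :=
  set_bij S S T /\
  {in S &, forall x y, Num.floor `|x - y| = Num.floor `|T x - T y|}.

Definition c0_pred (R : realType) : {pred nat -> R} :=
  mem [set u : nat -> R | u @ \oo --> (0 : R)].

Arguments c0_pred : clear implicits.

Record c0 (R : realType) := C0 {
  c0_fun :> nat -> R;
  c0_funP : c0_fun \in c0_pred R }.

Section c0_lmodule.
Variable R : realType.

Lemma c0_submod_closed : submod_closed (c0_pred R).
Proof.
split=> [|a u v]; rewrite !inE /=; first exact: cvg_cst.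
move=> u0 v0; rewrite -[X in _ --> X](addr0 0) -[X in _ --> X + _](scaler0 _ a).
by apply: cvgD => //; apply: cvgZr.
Qed.

HB.instance Definition _ :=
  GRing.isSubmodClosed.Build R (nat -> R) (c0_pred R) c0_submod_closed.
HB.instance Definition _ := [isSub for @c0_fun R].
HB.instance Definition _ := [Choice of c0 R by <:].
HB.instance Definition _ := [SubChoice_isSubLmodule of c0 R by <:].

End c0_lmodule.

Section c0_norm.
Variable R : realType.
Implicit Types u v : c0 R.

Definition c0_norm u : R := sup (range (fun n => `|u n|)).

Lemma c0_cvg u : (u : nat -> R) @ \oo --> (0 : R).
Proof. by have := c0_funP u; rewrite inE. Qed.

Lemma c0_has_ubound u : has_ubound (range (fun n => `|u n|)).
Proof.
have /cvg_seq_bounded/bounded_fun_has_ubound : cvgn (fun n => `|u n|).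
  by apply/cvg_ex; exists `|0 : R|; exact: cvg_norm (c0_cvg u).
by [].
Qed.

Lemma c0_norm_ub u n : `|u n| <= c0_norm u.
Proof. by apply: ub_le_sup; [exact: c0_has_ubound|exists n]. Qed.

Lemma c0_norm_le u (M : R) : (forall n, `|u n| <= M) -> c0_norm u <= M.
Proof.
move=> uM; apply: ge_sup; first by exists `|u 0%N|; exists 0%N.
by move=> _ [n _ <-].
Qed.

Lemma c0_normD u v : c0_norm (u + v) <= c0_norm u + c0_norm v.
Proof.
apply: c0_norm_le => n; apply: le_trans (ler_normD (u n) (v n)) _.
by rewrite lerD// c0_norm_ub.
Qed.

Lemma c0_normZ (a : R) u : c0_norm (a *: u) = `|a| * c0_norm u.
Proof.
have le (b : R) v : c0_norm (b *: v) <= `|b| * c0_norm v.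
  apply: c0_norm_le => n; rewrite (_ : (b *: v) n = b * v n)// normrM.
  by rewrite ler_wpM2l// c0_norm_ub.
apply/eqP; rewrite eq_le le /=; have [->|a0] := eqVneq a 0.
  rewrite normr0 mul0r; apply: le_trans (c0_norm_ub _ 0%N).
  exact: normr_ge0.
rewrite -ler_pdivlMl ?normr_gt0//.
have := le a^-1 (a *: u); rewrite scalerA mulVf// scale1r => /le_trans; apply.
by rewrite normfV.
Qed.

Lemma c0_norm0_eq0 u : c0_norm u = 0 -> u = 0.
Proof.
move=> u0; apply/val_inj/funext => n; apply/eqP.
by rewrite -normr_le0 -u0 c0_norm_ub.
Qed.

HB.instance Definition _ :=
  Lmodule_isNormed.Build R (c0 R) c0_normD c0_normZ c0_norm0_eq0.

Lemma c0_normE u : `|u| = sup (range (fun n => `|u n|)).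
Proof. by []. Qed.

End c0_norm.

Section c0_complete.
Variable R : realType.

Let c0_ball_coord (w u : c0 R) (e : R) n : ball w e u -> `|w n - u n| < e.
Proof.
rewrite -ball_normE /= => wu.
by apply: le_lt_trans wu; exact: (c0_norm_ub (w - u) n).
Qed.

Lemma c0_cauchy_cvg (F : set_system (c0 R)) :
  ProperFilter F -> cauchy F -> cvg F.
Proof.
move=> FF Fc.
have Fex (e : R) : 0 < e -> exists w : c0 R, F (ball w e).
  by move/cauchyP : Fc; exact.
have Fl n : cvg ((fun u : c0 R => u n) @ F).
  apply: R_complete; apply/cauchyP => e /Fex[w Fw]; exists (w n).
  suff: F [set u : c0 R | ball (w n) e (u n)] by [].
  by apply: (filterS _ Fw) => u; exact: c0_ball_coord.
pose l n : R := lim ((fun u : c0 R => u n) @ F).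
have wl (w : c0 R) (e : R) : F (ball w e) -> forall n, `|w n - l n| <= e.
  move=> Fw n.
  have h : (fun u : c0 R => `|w n - u n|) @ F --> `|w n - l n|.
    by apply: cvg_norm; apply: cvgB; [exact: cvg_cst|exact: Fl].
  apply: (cvgr_to_le h).
  by apply: filterS Fw => u /(c0_ball_coord n)/ltW.
have l0 : l \in c0_pred R.
  rewrite inE /=; apply/cvgr0Pnorm_le => e e0.
  have [w Fw] := Fex _ (divr_gt0 e0 (ltr0n R 2)).
  have /cvgr0Pnorm_le/(_ _ (divr_gt0 e0 (ltr0n R 2))) := c0_cvg w.
  apply: filterS => n wn.
  rewrite -[l n](subKr (w n)) (le_trans (ler_normB _ _))// (splitr e).
  by rewrite lerD// wl.
apply/cvg_ex; exists (C0 l0); apply/cvgrPdist_le => /= e e0.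
have [w Fw] := Fex _ (divr_gt0 e0 (ltr0n R 2)).
apply: (filterS _ Fw) => u wu.
apply: c0_norm_le => n; rewrite (_ : (_ - u) n = l n - u n)//.
rewrite -(subrKA (w n)) (le_trans (ler_normD _ _))// (splitr e) lerD//.
  by rewrite distrC wl.
exact/ltW/c0_ball_coord.
Qed.

HB.instance Definition _ := Uniform_isComplete.Build (c0 R) c0_cauchy_cvg.

End c0_complete.

(* Main.v *)
Require Import Defs.
From mathcomp Require Import all_boot all_order all_algebra.
From mathcomp Require Import all_classical all_reals all_analysis.
From mathcomp Require Import ring lra.

Set Implicit Arguments.
Unset Strict Implicit.
Unset Printing Implicit Defensive.

Import Order.TTheory GRing.Theory Num.Theory.
Import numFieldNormedType.Exports.

Local Open Scope classical_set_scope.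
Local Open Scope ring_scope.

(** If [g] is an increasing bijection of [[0, 1)], then
    [x |-> floor x + g (x - floor x)] preserves the integer part of distances on
    the real line, and a product of such maps does so for the sup distance.  Let
    [g] in the [n]-th factor be a rational Moebius map sending [1/(n+2)] to
    [1/2].  The product map is a bijection of the finitely supported rational
    sequences.  An extension to [c0] would send [x = (1/(n+2))_n] to some [y];
    the points [(x_n - k) e_n] lie at distance at least [k] from [x] and are
    mapped to [(1/2 - k) e_n], which for [k > |y|] forces [y_n >= 1/2] for every
    [n], so [y] does not tend to [0]. *)

(** * Moebius maps of the unit interval *)

Definition mobius (F : fieldType) (a t : F) : F := a * t / (1 + (a - 1) * t).

Lemma fmorph_mobius (F K : fieldType) (f : {rmorphism F -> K}) (a t : F) :
  f (mobius a t) = mobius (f a) (f t).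
Proof. by rewrite fmorph_div rmorphD rmorph1 !rmorphM rmorphB rmorph1. Qed.

Section mobius.
Variable F : realFieldType.
Implicit Types a s t : F.

Lemma mobius_den_gt0 a t : 0 < a -> 0 <= t < 1 -> 0 < 1 + (a - 1) * t.
Proof. by move=> a0 /andP[t0 t1]; nra. Qed.

Lemma mobius_itv a t : 0 < a -> 0 <= t < 1 -> 0 <= mobius a t < 1.
Proof.
move=> a0 t01; have d0 := mobius_den_gt0 a0 t01.
case/andP: t01 => t0 t1; rewrite /mobius divr_ge0 ?(ltW d0)//=.
  by rewrite ltr_pdivrMr//; lra.
by rewrite mulr_ge0// ltW.
Qed.

Lemma mobius_lt a s t : 0 < a -> 0 <= s -> s < t -> t < 1 ->
  mobius a s < mobius a t.
Proof.
move=> a0 s0 st t1.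
have ds : 0 < 1 + (a - 1) * s by rewrite mobius_den_gt0// s0 (lt_trans st).
have dt : 0 < 1 + (a - 1) * t
  by rewrite mobius_den_gt0// t1 (le_trans s0)// ltW.
rewrite /mobius ltr_pdivrMr// mulrAC ltr_pdivlMr// -subr_gt0.
rewrite (_ : _ - _ = a * (t - s)); last by ring.
by rewrite mulr_gt0// subr_gt0.
Qed.

(** In the coordinate [t / (1 - t)] the map [mobius a] is multiplication by [a]. *)
Lemma mobiusK a t : 0 < a -> 0 <= t < 1 -> mobius a^-1 (mobius a t) = t.
Proof.
move=> a0 t01; have := mobius_den_gt0 a0 t01; rewrite /mobius => d0.
have an0 : a != 0 by rewrite gt_eqF.
have dn0 : 1 + (a - 1) * t != 0 by rewrite gt_eqF.
field; do ?[apply/andP; split] => //.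
by rewrite (_ : _ + _ = 1) ?oner_neq0//; ring.
Qed.

(** At [t = 1 / (a + 1)] the ratio [t / (1 - t)] is [1 / a]; multiplied by [a] it becomes 1, the
    ratio of the midpoint. *)
Lemma mobius_inv_succ a : 0 < a -> mobius a (a + 1)^-1 = 2^-1.
Proof.
move=> a0; rewrite /mobius.
have a1 : a + 1 != 0 by rewrite gt_eqF// addr_gt0.
have an0 : a != 0 by rewrite gt_eqF.
field; do ?[apply/andP; split] => //.
by rewrite (_ : _ + _ = 2 * a) ?mulf_neq0//; ring.
Qed.

End mobius.

(** * Extension to the line, commuting with integer shifts *)

Lemma floor_ratr (R : archiRealFieldType) (q : rat) :
  Num.floor (ratr q : R) = Num.floor q.
Proof.
apply: floor_def; have /andP[h1 h2] := floor_itv q.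
by rewrite -!(ratr_int R) ler_rat ltr_rat h1.
Qed.

Definition stretch (F : archiRealFieldType) (a x : F) : F :=
  (Num.floor x)%:~R + mobius a (x - (Num.floor x)%:~R).

Lemma ratr_stretch (F : archiRealFieldType) (a q : rat) :
  ratr (stretch a q) = stretch (ratr a) (ratr q) :> F.
Proof.
rewrite /stretch floor_ratr rmorphD /= ratr_int fmorph_mobius rmorphB /=.
by rewrite ratr_int.
Qed.

Section stretch.
Variable F : archiRealFieldType.
Implicit Types (a x y : F) (k : int).

Lemma frac_itv x : 0 <= x - (Num.floor x)%:~R < 1.
Proof.
by have := floor_itv x; rewrite intrD => /andP[? ?]; apply/andP; split; lra.
Qed.

Lemma stretch0 a : stretch a 0 = 0.
Proof. by rewrite /stretch floor0 subrr add0r /mobius mulr0 mul0r. Qed.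

Lemma stretchDz a x k : stretch a (x + k%:~R) = stretch a x + k%:~R.
Proof.
rewrite /stretch floorDrz ?intr_int// intrKfloor intrD opprD addrACA subrr addr0.
by rewrite addrAC.
Qed.

Lemma floor_stretch a x : 0 < a -> Num.floor (stretch a x) = Num.floor x.
Proof.
move=> a0; apply: floor_def; have := mobius_itv a0 (frac_itv x).
rewrite /stretch intrD => /andP[? ?]; apply/andP; split; lra.
Qed.

Lemma stretchK a : 0 < a -> cancel (stretch a) (stretch a^-1).
Proof.
move=> a0 x; rewrite {1}/stretch floor_stretch// {1}/stretch addrAC subrr add0r.
by rewrite mobiusK ?frac_itv// addrC subrK.
Qed.

Lemma stretch_lt a : 0 < a -> {homo stretch a : x y / x < y}.
Proof.
(* Within one unit interval [mobius] is increasing; otherwise the floors differ and are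
   preserved. *)
move=> a0 x y xy; have := le_floor (ltW xy); rewrite le_eqVlt => /orP[/eqP e|e].
  rewrite /stretch e ltrD2l; apply: mobius_lt => //.
  - by rewrite -e; have /andP[] := frac_itv x.
  - by rewrite ltrD2r.
  - by have /andP[] := frac_itv y.
apply: contraLR e; rewrite -!leNgt => /le_floor.
by rewrite !floor_stretch.
Qed.

Lemma stretch_ltE a : 0 < a -> {mono stretch a : x y / x < y}.
Proof. by move=> a0; apply/leW_mono/le_mono/stretch_lt. Qed.

(** The condition reads [y - k < x < y + k], and [stretch a] is strictly increasing and commutes
    with the shifts by [k]. *)
Lemma stretch_dist_lt a x y k : 0 < a ->
  (`|stretch a x - stretch a y| < k%:~R) = (`|x - y| < k%:~R).
Proof.
by move=> a0; rewrite !ltr_distl !ltrBlDr -!stretchDz !stretch_ltE.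
Qed.

End stretch.

(** Reduces floors to strict integer bounds, which can be checked coordinatewise; take [k] to be the
    floor of [y] plus one. *)
Lemma floor_le_floor (R : archiRealDomainType) (x y : R) : 0 <= y ->
  (forall k : int, 0 < k -> y < k%:~R -> x < k%:~R) ->
  Num.floor x <= Num.floor y.
Proof.
move=> y0 h; rewrite -ltzD1 floor_lt_int h ?floorD1_gt//.
by rewrite ltzD1 floor_ge0.
Qed.

(** * Finitely supported rational sequences *)

Section c0.
Variable R : realType.
Implicit Types (u v : c0 R) (a : nat -> rat).

Lemma c0_subE u v n : (u - v) n = u n - v n.
Proof. by []. Qed.

Lemma c0_norm_ge u n : `|u n| <= `|u|.
Proof. exact: c0_norm_ub. Qed.

(** The supremum keeps the bound strict: the tail is at most [e / 2], so only finitely many terms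
    matter. *)
Lemma c0_norm_lt u (e : R) : 0 < e -> (forall n, `|u n| < e) -> `|u| < e.
Proof.
move=> e0 ue.
have /cvgr0Pnorm_le/(_ _ (divr_gt0 e0 (ltr0n R 2)))[N _ uN] := c0_cvg u.
apply: (@le_lt_trans _ _ (\big[Order.max/e / 2]_(i < N) `|u i|)).
  apply: c0_norm_le => n; have [Nn|nN] := leqP N n.
    by apply: le_trans (uN n Nn) _; exact: bigmax_ge_id.
  exact: (le_bigmax _ (fun i : 'I_N => `|u i|) (Ordinal nN)).
by apply/bigmax_ltP; split=> [|i _]; [lra | exact: ue].
Qed.

Lemma finsupp_c0 (f : nat -> R) N :
  (forall n, (N <= n)%N -> f n = 0) -> f \in c0_pred R.
Proof.
move=> f0; rewrite inE /=; apply/cvgr0Pnorm_le => e e0; exists N => // n Nn.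
by rewrite f0// normr0 ltW.
Qed.

(** Junk value [0] when [f] does not tend to [0]. *)
Definition c0_of (f : nat -> R) : c0 R := insubd 0 f.

Lemma c0_ofE (f : nat -> R) : f \in c0_pred R -> c0_of f = f :> (nat -> R).
Proof. by move=> f0; exact: (insubdK _ f0). Qed.

Definition rat_c00 : set (c0 R) := [set u | exists s : seq rat,
  forall n, u n = ratr (nth 0 s n)].

Lemma c0_of_rat (s : seq rat) n :
  c0_of (fun n => ratr (nth 0 s n)) n = ratr (nth 0 s n).
Proof.
rewrite c0_ofE//; apply: (@finsupp_c0 _ (size s)) => m sm.
by rewrite nth_default// rmorph0.
Qed.

Lemma c0_eq u v : (forall n, u n = v n) -> u = v.
Proof. by move=> uv; apply/val_inj/funext. Qed.

Lemma countable_rat_c00 : countable rat_c00.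
Proof.
pose f (s : seq rat) := c0_of (fun n => ratr (nth 0 s n)).
apply: (@sub_countable _ _ _ (range f)).
  apply: subset_card_le => u [s us]; exists s => //.
  by apply: c0_eq => n; rewrite us c0_of_rat.
by apply: sub_countable (card_image_le _ _) _; exact: countableP.
Qed.


Lemma dense_rat_c00 : dense rat_c00.
Proof.
move=> O [u Ou] oO; have : nbhs u O by exact: open_nbhs_nbhs.
rewrite -nbhs_ballE => -[e /= e0 eO].
have e20 : 0 < e / 2 by rewrite divr_gt0.
have /cvgr0Pnorm_lt/(_ _ e0)[N _ uN] := c0_cvg u.
have q n : {q : rat | `|u n - ratr q| < e}.
  apply: cid; have [|q] := @rat_in_itvoo _ (u n - e) (u n + e); first by lra.
  by rewrite in_itv/= => /andP[? ?]; exists q; rewrite ltr_distlC; apply/andP.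
(* Truncate at [N], beyond which the terms of [u] are already smaller than [e]. *)
pose s := mkseq (fun n => sval (q n)) N.
exists (c0_of (fun n => ratr (nth 0 s n))); split; last first.
  by exists s => n; rewrite c0_of_rat.
apply: eO; rewrite -ball_normE /=; apply: c0_norm_lt => // n.
rewrite c0_subE c0_of_rat.
have [nN|nN] := ltnP n N; first by rewrite nth_mkseq//; exact: svalP (q n).
by rewrite nth_default ?size_mkseq// rmorph0 subr0 uN.
Qed.

(** * The coordinatewise step-isometry *)

Definition coordstretch (a : nat -> rat) u : c0 R :=
  c0_of (fun n => stretch (ratr (a n)) (u n)).

(** Since [stretch] fixes 0, finite support is kept and [c0_of] returns no junk. For unbounded [a]
    this can fail on other null sequences. *)
Lemma coordstretchE (a : nat -> rat) u n : rat_c00 u ->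
  coordstretch a u n = stretch (ratr (a n)) (u n).
Proof.
move=> [s us]; rewrite c0_ofE//; apply: (@finsupp_c0 _ (size s)) => m sm.
by rewrite us nth_default// rmorph0 stretch0.
Qed.

Lemma coordstretch_rat (a : nat -> rat) u : rat_c00 u ->
  rat_c00 (coordstretch a u).
Proof.
move=> Su; have [s us] := Su.
exists (mkseq (fun n => stretch (a n) (nth 0 s n)) (size s)) => n.
rewrite coordstretchE// us -ratr_stretch; congr ratr.
have [ns|ns] := ltnP n (size s); first by rewrite nth_mkseq.
by rewrite !nth_default ?size_mkseq// stretch0.
Qed.

(** With [b] given pointwise, the lemma serves both orders of composition. *)
Lemma coordstretchK (a b : nat -> rat) : (forall n, 0 < a n) ->
  (forall n, b n = (a n)^-1) ->
  {in rat_c00, cancel (coordstretch a) (coordstretch b)}.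
Proof.
move=> a0 ba u /set_mem Su; apply: c0_eq => n.
rewrite coordstretchE; last exact: coordstretch_rat.
by rewrite coordstretchE// ba fmorphV stretchK// ltr0q.
Qed.

Lemma coordstretch_floor (a : nat -> rat) : (forall n, 0 < a n) ->
  {in rat_c00 &, forall u v,
    Num.floor `|u - v| = Num.floor `|coordstretch a u - coordstretch a v|}.
Proof.
move=> a0 u v /set_mem Su /set_mem Sv.
have E n : (coordstretch a u - coordstretch a v) n =
    stretch (ratr (a n)) (u n) - stretch (ratr (a n)) (v n).
  by rewrite -!coordstretchE.
apply/eqP; rewrite eq_le; apply/andP.
split; apply: floor_le_floor => // k k0 uvk;
  apply: c0_norm_lt; rewrite ?ltr0z// => n.
- rewrite -(stretch_dist_lt (a := ratr (a n))) ?ltr0q// -E.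
  exact: le_lt_trans (c0_norm_ge _ _) uvk.
- rewrite E stretch_dist_lt ?ltr0q//.
  exact: le_lt_trans (c0_norm_ge (u - v) n) uvk.
Qed.

Lemma coordstretch_step_isometry (a : nat -> rat) : (forall n, 0 < a n) ->
  step_isometry rat_c00 (coordstretch a).
Proof.
move=> a0; split; last exact: coordstretch_floor.
have aV0 n : 0 < (a n)^-1 by rewrite invr_gt0.
have aK :
    {in rat_c00, cancel (coordstretch a) (coordstretch (fun n => (a n)^-1))}.
  exact: coordstretchK.
split; first by move=> u; exact: coordstretch_rat.
  exact: can_in_inj aK.
move=> u Su; exists (coordstretch (fun n => (a n)^-1) u).
  exact: coordstretch_rat.
by apply: coordstretchK; rewrite ?inE// => n; rewrite invrK.
Qed.

End c0.

(** * Absence of an extension *)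

Lemma harmonic1_c0 (R : realType) : (fun n => harmonic n.+1) \in c0_pred R.
Proof.
by rewrite inE /= (cvg_shiftS (@harmonic R)); exact: cvg_harmonic.
Qed.

Lemma stretch_harmonic1 (R : realType) (n : nat) (k : nat) :
  stretch n.+1%:R (harmonic n.+1 - k%:R : R) = 2^-1 - k%:R.
Proof.
rewrite -[k%:R]/((k%:Z)%:~R) -rmorphN stretchDz; congr (_ + _).
have f0 : Num.floor (harmonic n.+1 : R) = 0.
  by apply: floor_def; rewrite add0r harmonic_ge0 /harmonic /= invf_lt1 ?ltr1n.
by rewrite /stretch f0 subr0 add0r /harmonic /= -[n.+2%:R]natr1 mobius_inv_succ.
Qed.

Lemma no_step_extension (R : realType) (Tbar : c0 R -> c0 R) :
  step_isometry [set: c0 R] Tbar ->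
  {in @rat_c00 R, Tbar =1 coordstretch (fun n => n.+1%:R)} -> False.
Proof.
move=> [_ Tfloor] TE; pose x := c0_of (fun n => harmonic n.+1 : R).
have xE n : x n = harmonic n.+1 by rewrite c0_ofE// harmonic1_c0.
set y := Tbar x.
suff y2 n : 2^-1 <= y n.
  have half0 : (0 : R) < 2^-1 by rewrite invr_gt0.
  have /cvgr0Pnorm_lt/(_ _ half0)[N _ /(_ N (leqnn N))] := c0_cvg y.
  by apply/negP; rewrite -leNgt; apply: le_trans (y2 N) (ler_norm _).
rewrite leNgt; apply/negP => yn.
pose k := (Num.truncn `|y|).+1.
have yk : `|y| < k%:R by exact: truncnS_gt.
have k1 : (1 : R) <= k%:R by rewrite ler1n.
(* The point [(x_n - k) e_n], built over [rat] so that it lies in [rat_c00]. *)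
pose s := set_nth 0 [::] n (harmonic n.+1 - k%:R : rat).
pose u : c0 R := c0_of (fun m => ratr (nth 0 s m)).
have uE m : u m = if m == n then harmonic n.+1 - k%:R else 0.
  rewrite c0_of_rat nth_set_nth /= nth_nil; case: ifP => _; last first.
    by rewrite rmorph0.
  by rewrite rmorphB /= /harmonic /= fmorphV /= !ratr_nat.
have Su : rat_c00 u by exists s => m; rewrite c0_of_rat.
have := Tfloor x u; rewrite (TE u) ?inE// => /(_ I I) fE.
have : k%:Z <= Num.floor `|x - u|.
  rewrite floor_ge_int; apply: le_trans (c0_norm_ge _ n).
  by rewrite c0_subE xE uE eqxx subKr ger0_norm.
(* Contradiction: the image distance is below [k]. At [n] the difference is [y n - 2^-1 + k], below
   [k] by [yn] and above [-k] since [-k < y n] and [1 <= k]; elsewhere it is [y m], of modulus at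
   most [|y| < k]. *)
rewrite fE leNgt floor_lt_int; apply/negP; rewrite negbK.
apply: c0_norm_lt; first exact: lt_le_trans k1.
move=> m; rewrite c0_subE coordstretchE// uE ratr_nat; have [->|mn] := eqVneq m n.
  rewrite stretch_harmonic1; have := c0_norm_ge y n.
  rewrite ler_norml => /andP[ny _]; rewrite -[k%:Z%:~R]/(k%:R) ltr_norml.
  by apply/andP; split; lra.
by rewrite stretch0 subr0; exact: le_lt_trans (c0_norm_ge _ _) yk.
Qed.

Theorem theorem10 (R : realType) :
  exists (S : set (c0 R)) (T : c0 R -> c0 R),
    [/\ countable S, dense S, step_isometry S T &
        ~ exists Tbar : c0 R -> c0 R,
            step_isometry [set: c0 R] Tbar /\ {in S, Tbar =1 T}].
Proof.
exists (@rat_c00 R), (coordstretch (fun n => n.+1%:R)); split.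
- exact: countable_rat_c00.
- exact: dense_rat_c00.
- exact: coordstretch_step_isometry.
- by move=> [Tbar [TbarP TbarE]]; exact: no_step_extension TbarP TbarE.
Qed.
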